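(* Let $\mu,\nu$ be finite signed Borel measures on $\mathbb{R}^n$ with compact support. If there exists $R>0$, with the supports of $\mu$ and $\nu$ contained in $\{x:|x|\le R\}$, such that $\widehat{\mu}(\zeta,\theta)=\widehat{\nu}(\zeta,\theta)$ for all $\zeta\in\mathbb{C}$ with $|\zeta|>R$ and all $\theta\in\mathbb{S}^{n-1}$, then $\mu$ and $\nu$ are identical.
   Context: $\mathbb{S}^{n-1}$ is the unit sphere of $\mathbb{R}^n$ and $\omega_n$ its surface area. For $\theta\in\mathbb{S}^{n-1}$ and $|x|\le R$, $\zeta\mapsto r(\zeta\theta-x)$ denotes the analytic continuation to $\{\zeta\in\mathbb{C}:|\zeta|>R\}$ of $\rho\mapsto|\rho\theta-x|$, $\rho>R$; it has no zeros there and satisfies $r(\zeta\theta-x)^2=\zeta^2-2\zeta\langle\theta,x\rangle+|x|^2$. For a finite signed measure $\mu$ with support in $\{x:|x|\le R\}$, its multivariate Markov transform is $$\widehat{\mu}(\zeta,\theta)=\frac1{\omega_n}\int_{\mathbb{R}^n}\frac{\zeta^{n-1}}{r(\zeta\theta-x)^n}\,d\mu(x),\qquad |\zeta|>R,\ \theta\in\mathbb{S}^{n-1}.$$ *)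

(* Defs.v *)
From HB Require Import structures.
From mathcomp Require Import all_boot all_order all_algebra.
From mathcomp Require Import all_classical all_reals all_analysis.
From mathcomp Require Import complex.

Set Implicit Arguments.
Unset Strict Implicit.
Unset Printing Implicit Defensive.

Import Order.TTheory GRing.Theory Num.Theory.
Import numFieldNormedType.Exports.

Local Open Scope classical_set_scope.
Local Open Scope ring_scope.
Local Open Scope complex_scope.

Section EuclideanSpace.
Context {R : realType}.

(* The library norm on ['rV[R]_n] is the sup norm, hence a separate definition
   of the Euclidean norm; the two induce the same topology. *)
Definition enorm n (x : 'rV[R]_n) : R := Num.sqrt (\sum_i x ord0 i ^+ 2).

Definition esphere n : set 'rV[R]_n := [set x | enorm x = 1].

Definition ecball n (r : R) : set 'rV[R]_n := [set x | enorm x <= r].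

(* Integral of a nonnegative function over R^n with respect to n-dimensional
   Lebesgue measure, as an iterated integral (Tonelli). *)
Fixpoint lebesgue_iint n : ('rV[R]_n -> \bar R) -> \bar R :=
  match n with
  | 0 => fun f => f 0
  | m.+1 => fun f =>
      (\int[lebesgue_measure]_(t in [set: R])
         lebesgue_iint (fun v : 'rV[R]_m => f (row_mx (t%:M : 'rV[R]_1) v)))%E
  end.

Definition lebesgue_vol n (A : set 'rV[R]_n) : \bar R :=
  lebesgue_iint (fun x => (\1_A x)%:E).

(* The surface measure of a set E of unit vectors is n times the volume of the
   cone over E (polar coordinates: the cone has volume
   [sigma E * \int_0^1 t ^ (n - 1) dt]). *)
Definition surface_measure n (E : set 'rV[R]_n) : \bar R :=
  (n%:R%:E * lebesgue_vol [set (t *: theta)%R | t in `]0%R, 1%R] & theta in E])%E.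

Definition sphere_area n : R := fine (surface_measure (@esphere n)).

End EuclideanSpace.

(* R^n with its Borel sigma-algebra. *)
Definition borel_rV (R : realType) (n : nat) :=
  g_sigma_algebraType (@open 'rV[R]_n).

Section Charges.
Context d (T : measurableType d) (R : realType).
Variable mu : {charge set T -> \bar R}.

Lemma hahn_pair_exists :
  exists PN : set T * set T, hahn_decomposition mu PN.1 PN.2.
Proof. by have [P [N PN]] := Hahn_decomposition mu; exists (P, N). Qed.

(* The Jordan decomposition does not depend on the Hahn decomposition chosen. *)
Definition hahn_pair := projT1 (cid hahn_pair_exists).
Definition hahn_pairP : hahn_decomposition mu hahn_pair.1 hahn_pair.2 :=
  projT2 (cid hahn_pair_exists).

Definition charge_pos : {measure set T -> \bar R} := jordan_pos hahn_pairP.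
Definition charge_neg : {measure set T -> \bar R} := jordan_neg hahn_pairP.

Definition charge_integral (D : set T) (f : T -> R) : R :=
  Rintegral charge_pos D f - Rintegral charge_neg D f.

Definition charge_integralC (D : set T) (f : T -> R[i]) : R[i] :=
  charge_integral D (fun x => complex.Re (f x)) +i*
  charge_integral D (fun x => complex.Im (f x)).

End Charges.

Section MarkovTransform.
Context {R : realType} {n : nat}.

Definition charge_support (mu : {charge set (borel_rV R n) -> \bar R}) :
    set 'rV[R]_n :=
  [set x | forall U : set 'rV[R]_n, open U -> U x ->
             (0 < charge_variation (hahn_pairP mu) U)%E].

Definition holomorphic_on (U : set R[i]) (f : R[i]^o -> R[i]^o) : Prop :=
  forall z : R[i], U z -> derivable f z 1.

Definition outer_domain (rad : R) : set R[i] := [set z | rad%:C < `|z|].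

Definition is_dist_continuation (rad : R) (theta x : 'rV[R]_n)
    (f : R[i]^o -> R[i]^o) : Prop :=
  holomorphic_on (outer_domain rad) f /\
  forall rho : R, rad < rho -> f rho%:C = (enorm (rho *: theta - x))%:C.

(* For [enorm theta = 1] and [enorm x <= rad] the continuation exists and its
   values on [outer_domain rad] are unique by the identity theorem; all other
   values of [dist_ext] are irrelevant. *)
Definition dist_ext (rad : R) (theta x : 'rV[R]_n) : R[i] -> R[i] :=
  xget (fun=> 0) [set f | is_dist_continuation rad theta x f].

(* The integrand is only meaningful on the closed ball of radius [rad]; since
   that ball contains the support of [mu], the integral over R^n is the one
   over the ball. *)
Definition markov_transform (rad : R)
    (mu : {charge set (borel_rV R n) -> \bar R})
    (zeta : R[i]) (theta : 'rV[R]_n) : R[i] :=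
  ((sphere_area n)^-1)%:C *
  charge_integralC mu (@ecball R n rad)
    (fun x => zeta ^+ n.-1 / dist_ext rad theta x zeta ^+ n).

End MarkovTransform.

(* Main.v *)
Require Import Defs.
From HB Require Import structures.
From mathcomp Require Import all_boot all_order all_algebra.
From mathcomp Require Import all_classical all_reals all_analysis.
From mathcomp Require Import complex measurable_realfun.
From mathcomp Require Import ring lra.

Set Implicit Arguments.
Unset Strict Implicit.
Unset Printing Implicit Defensive.

Import Order.TTheory GRing.Theory Num.Theory.
Import numFieldNormedType.Exports.

Local Open Scope classical_set_scope.
Local Open Scope ring_scope.
Local Open Scope complex_scope.

(** At real zeta = rho > rad the continued distance is the Euclidean one, so
    after division by the nonzero factor rho^(n-1) / omega_n the hypothesis
    says that the signed measure sigma = mu - nu, carried by the ball B of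
    radius rad, satisfies
      int_B |y - x|^(-n) d sigma(x) = 0   whenever |y| > rad.      (1)
    Moving negative parts to the other side, sigma is handled as the difference
    of the finite positive measures mu^+ + nu^- and nu^+ + mu^-.

    The heart of the proof is a step that raises the exponent by 2 and the
    degree of a polynomial density by 1. Let w be a bounded function, let
    F_m(w)(y) = int_B w(x) |y - x|^(-m) d sigma(x), and suppose that F_m(w)
    vanishes outside B for some m > 0. The i-th partial derivative
    in y gives
      y_i F_(m+2)(w) = F_(m+2)(x_i w),                               (2)
    and differentiating (2) once more in the same direction gives
      F_(m+2)(w) = (m+2) F_(m+4)((y_i - x_i)^2 w).
    Summing over i restores the factor |y - x|^2 on the right, so that
    n F_(m+2)(w) = (m+2) F_(m+2)(w). If m + 2 differs from n, that
    is, if |y|^(-m) is not harmonic, then F_(m+2)(w) = 0, and by (2) also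
    F_(m+2)(x_i w) = 0. Starting from (1), where m = n, every
    polynomial p therefore satisfies F_(n+2d)(p) = 0 outside B for some d
    (lemmas null_potential_succ, null_potential_coord and annihilated_poly).
    Multiplying by |y|^(n+2d) and letting y tend to infinity yields
    int_B p d sigma = 0 (null_potential_diff_int).

    To conclude from the moments, the polynomials (1 - u^k)^(k 2^k) converge
    boundedly on [0,1] to the indicator of u < 1/2. Products of such
    polynomials in the coordinates converge to indicators of half-open boxes
    (diff_int_box), and boxes generate the Borel sets (eq_measure_boxes).

    Three facts connect this argument with the definition of the transform. The
    continuation exists, so that dist_ext is one (dist_continuation_exists);
    the area of the sphere is positive and finite (sphere_area_gt0); and the
    total variation vanishes off any measurable set containing the support,
    because the space is second countable (charge_support_null). *)

(** * Euclidean norm *)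

Section Enorm.
Context {R : realType} {n : nat}.
Implicit Types x y : 'rV[R]_n.

Lemma enorm_ge0 x : 0 <= enorm x. Proof. exact: sqrtr_ge0. Qed.

Lemma sqr_enorm x : enorm x ^+ 2 = \sum_i x ord0 i ^+ 2.
Proof. by rewrite sqr_sqrtr// sumr_ge0// => i _; exact: sqr_ge0. Qed.

Lemma enormZ (t : R) x : enorm (t *: x) = `|t| * enorm x.
Proof.
rewrite /enorm -sqrtr_sqr -sqrtrM ?sqr_ge0// mulr_sumr.
by congr Num.sqrt; apply: eq_bigr => i _; rewrite mxE exprMn.
Qed.

Lemma enormN x : enorm (- x) = enorm x.
Proof. by rewrite -scaleN1r enormZ normrN1 mul1r. Qed.

Lemma coord_le_enorm x i : `|x ord0 i| <= enorm x.
Proof.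
rewrite -sqrtr_sqr ler_sqrt; last first.
  by apply: sumr_ge0 => j _; exact: sqr_ge0.
by rewrite (bigD1 i)//= lerDl sumr_ge0// => j _; exact: sqr_ge0.
Qed.

Lemma dot_sqr_le x y :
  (\sum_i x ord0 i * y ord0 i) ^+ 2 <= enorm x ^+ 2 * enorm y ^+ 2.
Proof.
set c := \sum_i _; have [y0|y0] := eqVneq (enorm y ^+ 2) 0.
  suff -> : c = 0 by rewrite expr0n/= mulr_ge0// sqr_ge0.
  apply: big1 => i _; suff -> : y ord0 i = 0 by rewrite mulr0.
  apply/normr0_eq0/eqP; rewrite eq_le normr_ge0 andbT.
  by rewrite (le_trans (coord_le_enorm _ _))//; move/eqP: y0; rewrite sqrf_eq0 => /eqP->.
have yp : 0 < enorm y ^+ 2 by rewrite lt0r y0 sqr_ge0.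
rewrite -subr_ge0 -(pmulr_rge0 _ yp).
(* |y|^2 times the gap is the squared norm of |y|^2 x - c y *)
suff <- : \sum_i (enorm y ^+ 2 * x ord0 i - c * y ord0 i) ^+ 2 =
    enorm y ^+ 2 * (enorm x ^+ 2 * enorm y ^+ 2 - c ^+ 2).
  by apply: sumr_ge0 => i _; exact: sqr_ge0.
transitivity (\sum_i ((enorm y ^+ 2) ^+ 2 * (x ord0 i) ^+ 2 -
    enorm y ^+ 2 * c * 2 * (x ord0 i * y ord0 i) + c ^+ 2 * (y ord0 i) ^+ 2)).
  by apply: eq_bigr => i _; ring.
rewrite big_split sumrB /= -!mulr_sumr -!sqr_enorm -/c; ring.
Qed.

Lemma ler_enormD x y : enorm (x + y) <= enorm x + enorm y.
Proof.
rewrite -(@ler_pXn2r _ 2) ?nnegrE ?addr_ge0 ?enorm_ge0//.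
have -> : enorm (x + y) ^+ 2 =
    enorm x ^+ 2 + 2 * (\sum_i x ord0 i * y ord0 i) + enorm y ^+ 2.
  rewrite !sqr_enorm mulr_sumr -!big_split/=.
  by apply: eq_bigr => i _; rewrite mxE; ring.
rewrite sqrrD lerD2r lerD2l -[leRHS]mulr_natl ler_wpM2l//.
rewrite (le_trans (ler_norm _))// -(@ler_pXn2r _ 2) ?nnegrE ?mulr_ge0 ?enorm_ge0//.
by rewrite exprMn real_normK ?num_real// dot_sqr_le.
Qed.

Lemma lerB_enorm x y : enorm x - enorm y <= enorm (x - y).
Proof. by rewrite lerBlDr (le_trans _ (ler_enormD _ _))// subrK. Qed.

Lemma enorm_delta (i : 'I_n) : enorm (delta_mx ord0 i : 'rV[R]_n) = 1.
Proof.
rewrite /enorm (bigD1 i)//= big1 ?addr0 ?mxE ?eqxx ?expr1n ?sqrtr1// => j ji.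
by rewrite mxE (negbTE ji) andbF expr0n.
Qed.

(** The squared distance is quadratic along a coordinate line; this reduces
    partial derivatives of the kernel to one-variable calculus. *)
Lemma sqr_enormD_delta x (i : 'I_n) (h : R) :
  enorm (x + h *: delta_mx ord0 i) ^+ 2 =
  enorm x ^+ 2 + 2 * x ord0 i * h + h ^+ 2.
Proof.
rewrite !sqr_enorm (bigD1 i)//= [X in _ = X + _ + _](bigD1 i)//= !mxE !eqxx/=.
rewrite [X in _ + X = _](eq_bigr (fun j => x ord0 j ^+ 2)); last first.
  by move=> j ji; rewrite !mxE (negbTE ji) andbF mulr0 addr0.
by rewrite mulr1; ring.
Qed.

End Enorm.

(** * Differentiating the kernel *)

Section KernelDerivative.
Context {R : realType} {n : nat}.
Implicit Types x y z : 'rV[R]_n.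

Lemma is_derive_enorm_inv_pow z (i : 'I_n) (m : nat) (t : R) :
  0 < enorm (z + t *: delta_mx ord0 i) ->
  is_derive t 1 (fun h : R => (enorm (z + h *: delta_mx ord0 i))^-1 ^+ m)
    (- m%:R * (z ord0 i + t) * (enorm (z + t *: delta_mx ord0 i))^-1 ^+ m.+2).
Proof.
set s := enorm _ => s0.
pose q (h : R) := enorm z ^+ 2 + 2 * z ord0 i * h + h ^+ 2.
have enormE h : enorm (z + h *: delta_mx ord0 i) = Num.sqrt (q h).
  by rewrite /q -sqr_enormD_delta sqrtr_sqr ger0_norm// enorm_ge0.
have qt : q t = s ^+ 2 by rewrite /q -sqr_enormD_delta.
have qt0 : 0 < q t by rewrite qt exprn_gt0.
have sqt : Num.sqrt (q t) = s by rewrite qt sqrtr_sqr gtr0_norm.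
have dq : is_derive t 1 q (2 * (z ord0 i + t)).
  have -> : q = cst (enorm z ^+ 2) + (2 * z ord0 i) *: (@id R) + (@id R) ^+ 2.
    by apply/funext => h; rewrite /q !fctE.
  have d1 := is_deriveZ (2 * z ord0 i) (is_derive_id t (1 : R)).
  have d2 := is_deriveX 2 (is_derive_id t (1 : R)).
  apply: is_derive_eq (is_deriveD (is_deriveD (is_derive_cst _ _ _) d1) d2) _.
  by rewrite /GRing.scale/= add0r !mulr1 expr1; ring.
have dsq : is_derive t 1 (Num.sqrt \o q) ((z ord0 i + t) * s^-1).
  have := @is_derive1_comp _ Num.sqrt q t _ _ (is_derive1_sqrt qt0) dq.
  move=> h; apply: is_derive_eq h _.
  rewrite sqt invfM; field.
  by rewrite gt_eqF.
have dinv : is_derive t 1 (fun h => ((Num.sqrt \o q) h)^-1)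
    (- (z ord0 i + t) * s^-1 ^+ 3).
  have /(@is_deriveV _ _ _ _ _) h : (Num.sqrt \o q) t != 0.
    by rewrite /= sqt gt_eqF.
  apply: is_derive_eq (h _ _ dsq) _.
  by rewrite /= sqt /GRing.scale/= -exprVn; ring.
have -> : (fun h : R => (enorm (z + h *: delta_mx ord0 i))^-1 ^+ m) =
    (fun h => ((Num.sqrt \o q) h)^-1) ^+ m.
  by apply/funext => h; rewrite exprfctE /= enormE.
apply: is_derive_eq.
rewrite /GRing.scale/= sqt; case: m => [|m]; first by rewrite !mul0r oppr0 !mul0r.
by rewrite /= ![_ ^+ m.+3]exprS !exprS; ring.
Qed.

End KernelDerivative.

(** * Bounded functions and the difference of two integrals *)

Section DifferenceOfIntegrals.
Context d (T : measurableType d) (R : realType) (B : set T).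
Implicit Types f g w : T -> R.

(** The integrands of the whole argument: on a finite measure they are
    integrable, and they form an algebra, so no integrability condition has to
    be carried along. *)
Definition bounded_measurable w :=
  measurable_fun B w /\ exists M : R, forall x, B x -> `|w x| <= M.

Lemma bounded_measurable_cst (c : R) : bounded_measurable (fun=> c).
Proof. by split; [exact: measurable_cst|exists `|c|]. Qed.

Lemma bounded_measurableD f g : bounded_measurable f -> bounded_measurable g ->
  bounded_measurable (fun x => f x + g x).
Proof.
move=> [mf [M fM]] [mg [N gN]]; split; first exact: measurable_funD.
by exists (M + N) => x Bx; rewrite (le_trans (ler_normD _ _))// lerD ?fM ?gN.
Qed.

Lemma bounded_measurableM f g : bounded_measurable f -> bounded_measurable g ->
  bounded_measurable (fun x => f x * g x).
Proof.
move=> [mf [M fM]] [mg [N gN]]; split; first exact: measurable_funM.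
by exists (M * N) => x Bx; rewrite normrM ler_pM ?fM ?gN.
Qed.

Lemma bounded_measurable_sum (I : Type) (s : seq I) (f : I -> T -> R) :
  (forall i, bounded_measurable (f i)) ->
  bounded_measurable (fun x => \sum_(i <- s) f i x).
Proof.
move=> bf; elim: s => [|i s ih].
  by under eq_fun do rewrite big_nil; exact: bounded_measurable_cst.
by under eq_fun do rewrite big_cons; exact: bounded_measurableD.
Qed.

Lemma bounded_measurable_cvg (f_ : nat -> T -> R) f (M : R) :
  (forall k, measurable_fun B (f_ k)) ->
  (forall k x, B x -> `|f_ k x| <= M) ->
  (forall x, B x -> f_ ^~ x @ \oo --> f x) ->
  bounded_measurable f.
Proof.
move=> mf fM f_f; split; first exact: measurable_fun_cvg f_f.
exists M => x Bx; have cvgn : `|f_ k x| @[k --> \oo] --> `|f x|.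
  by apply: cvg_norm; exact: f_f.
by apply: (cvgr_to_le cvgn); apply: nearW => k; exact: fM.
Qed.

Hypothesis mB : measurable B.

Lemma integrable_bounded_measurable (mu : {measure set T -> \bar R}) w :
  (mu setT < +oo)%E -> bounded_measurable w -> mu.-integrable B (EFin \o w).
Proof.
move=> muoo [mw [M wM]]; apply: measurable_bounded_integrable => //.
  by rewrite (le_lt_trans _ muoo)// le_measure ?inE.
exists M; split; rewrite ?num_real// => r Mr x Bx /=.
by rewrite (le_trans (wM x Bx))// ltW.
Qed.

Variables alpha beta : {measure set T -> \bar R}.
Hypotheses (alphaoo : (alpha setT < +oo)%E) (betaoo : (beta setT < +oo)%E).

(** Integral against the signed measure alpha - beta; keeping two positive
    measures gives access to the integration theory of positive measures. *)
Definition diff_int w : R :=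
  \int[alpha]_(x in B) w x - \int[beta]_(x in B) w x.

Lemma eq_diff_int f g : {in B, f =1 g} -> diff_int f = diff_int g.
Proof. by move=> fg; congr (_ - _); exact: eq_Rintegral. Qed.

Lemma diff_int0 : diff_int (fun=> 0) = 0.
Proof. by rewrite /diff_int !Rintegral_cst// !mul0r subrr. Qed.

Lemma diff_intD f g : bounded_measurable f -> bounded_measurable g ->
  diff_int (fun x => f x + g x) = diff_int f + diff_int g.
Proof.
move=> bf bg; rewrite /diff_int !RintegralD//; first ring.
all: exact: integrable_bounded_measurable.
Qed.

Lemma diff_intZ (c : R) f : bounded_measurable f ->
  diff_int (fun x => c * f x) = c * diff_int f.
Proof.
move=> bf; rewrite /diff_int !RintegralZl ?mulrBr//.
all: exact: integrable_bounded_measurable.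
Qed.

Lemma diff_int_sum (I : Type) (s : seq I) (f : I -> T -> R) :
  (forall i, bounded_measurable (f i)) ->
  diff_int (fun x => \sum_(i <- s) f i x) = \sum_(i <- s) diff_int (f i).
Proof.
move=> bf; elim: s => [|i s ih].
  by under eq_fun do rewrite big_nil; rewrite big_nil diff_int0.
under eq_fun do rewrite big_cons.
by rewrite big_cons diff_intD ?ih//; exact: bounded_measurable_sum.
Qed.

Let Rintegral_cvg (mu : {measure set T -> \bar R}) (f_ : nat -> T -> R) f M :
  (mu setT < +oo)%E ->
  (forall k, measurable_fun B (f_ k)) ->
  (forall k x, B x -> `|f_ k x| <= M) ->
  (forall x, B x -> f_ ^~ x @ \oo --> f x) ->
  (\int[mu]_(x in B) f_ k x)%R @[k --> \oo] --> (\int[mu]_(x in B) f x)%R.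
Proof.
move=> muoo mf fM f_f.
have [mf0 _] := bounded_measurable_cvg mf fM f_f.
have bf := bounded_measurable_cvg mf fM f_f.
have mF k : measurable_fun B (EFin \o f_ k) by apply/measurable_EFinP; exact: mf.
have mF0 : measurable_fun B (EFin \o f) by apply/measurable_EFinP.
have F_F : {ae mu, forall x, B x -> (EFin \o f_ k) x @[k --> \oo] --> (EFin \o f) x}.
  by apply: aeW => x Bx; apply: cvg_EFin; [exact: nearW|exact: f_f].
have iM : mu.-integrable B (EFin \o (fun=> M)).
  by apply: integrable_bounded_measurable => //; exact: bounded_measurable_cst.
have FM : {ae mu, forall x k, B x -> (`|(EFin \o f_ k) x| <= (EFin \o (fun=> M)) x)%E}.
  by apply: aeW => x k Bx /=; rewrite lee_fin fM.
have [_ _ h] := dominated_convergence mB mF mF0 F_F iM FM.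
apply: fine_cvg; rewrite fineK//.
by apply: integrable_fin_num => //; exact: integrable_bounded_measurable.
Qed.

Lemma diff_int_cvg (f_ : nat -> T -> R) f M :
  (forall k, measurable_fun B (f_ k)) ->
  (forall k x, B x -> `|f_ k x| <= M) ->
  (forall x, B x -> f_ ^~ x @ \oo --> f x) ->
  diff_int (f_ k) @[k --> \oo] --> diff_int f.
Proof.
move=> mf fM f_f; apply: cvgB; first exact: (Rintegral_cvg alphaoo mf fM).
exact: (Rintegral_cvg betaoo mf fM).
Qed.

Lemma is_derive_diff_int (f df : R -> T -> R) (u v a M : R) :
  a \in `]u, v[ ->
  (forall t, t \in `]u, v[ -> bounded_measurable (f t)) ->
  (forall t x, t \in `]u, v[ -> B x -> is_derive t 1 (f ^~ x) (df t x)) ->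
  (forall t x, t \in `]u, v[ -> B x -> `|df t x| <= M) ->
  is_derive a 1 (fun t => diff_int (f t)) (diff_int (df a)).
Proof.
move=> auv bf dfE dfM.
have d1E t x : t \in `]u, v[ -> B x -> partial1of2 f t x = df t x.
  by move=> tuv Bx; rewrite partial1of2E; have [_ ->] := dfE t x tuv Bx.
suff int_der (mu : {measure set T -> \bar R}) : (mu setT < +oo)%E ->
    is_derive a 1 (fun t => \int[mu]_(x in B) f t x)%R
      (\int[mu]_(x in B) df a x)%R.
  exact: is_deriveB (int_der _ alphaoo) (int_der _ betaoo).
move=> muoo.
have intf t : `]u, v[%classic t -> mu.-integrable B (EFin \o f t).
  by move=> tuv; apply: integrable_bounded_measurable => //; exact: bf.
have derf t x : `]u, v[%classic t -> B x -> derivable (f ^~ x) t 1.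
  by move=> tuv Bx; have [] := dfE t x tuv Bx.
have d1M t x : `]u, v[%classic t -> B x -> `|partial1of2 f t x| <= `|M|.
  by move=> tuv Bx; rewrite d1E// (le_trans (dfM _ _ _ _))// ler_norm.
have intM : mu.-integrable B (EFin \o (fun=> `|M|)).
  by apply: integrable_bounded_measurable => //; exact: bounded_measurable_cst.
apply: DeriveDef.
  exact: (derivable_under_integral mB auv intf derf (fun=> normr_ge0 M) intM d1M).
rewrite -derive1E.
rewrite (differentiation_under_integral mB auv intf derf (fun=> normr_ge0 M) intM d1M).
by apply: eq_Rintegral => x; rewrite inE => Bx; exact: d1E.
Qed.

End DifferenceOfIntegrals.

(** * Borel functions on the Euclidean space *)

Section BorelFunctions.
Context {R : realType} {n : nat}.

(** The measurable sets of the space are generated by its open sets, and those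
    of the line by the open intervals. *)
Lemma continuous_measurable_rV (f : 'rV[R]_n -> R) : continuous f ->
  measurable_fun setT (f : borel_rV R n -> R).
Proof.
move=> /continuousP cf; apply: (measurability _ (RGenOpens.measurableE R)).
move=> _ [_ [a [b ->] <-]]; rewrite setTI; apply: sub_sigma_algebra.
exact/cf/interval_open.
Qed.

Lemma measurable_coord (i : 'I_n) :
  measurable_fun setT (fun x : borel_rV R n => (x : 'rV[R]_n) ord0 i).
Proof. by apply: continuous_measurable_rV => x; exact: coord_continuous. Qed.

Lemma measurable_enorm_sub (y : 'rV[R]_n) :
  measurable_fun setT (fun x : borel_rV R n => enorm (y - (x : 'rV[R]_n))).
Proof.
have msqrt : measurable_fun setT (@Num.sqrt R).
  by apply: continuous_measurable_fun; exact: sqrt_continuous.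
apply: (measurableT_comp msqrt).
apply: measurable_sum => i; under eq_fun do rewrite !mxE.
apply: measurable_funX; apply: measurable_funB => //.
exact: measurable_coord.
Qed.

Lemma measurable_ecball (r : R) :
  measurable (@ecball R n r : set (borel_rV R n)).
Proof.
have -> : (@ecball R n r : set (borel_rV R n)) =
    setT `&` (fun x : borel_rV R n => enorm (0 - (x : 'rV[R]_n))) @^-1` `]-oo, r].
  by rewrite setTI; apply/seteqP; split => x /=; rewrite in_itv/= sub0r enormN.
by apply: measurable_enorm_sub => //; exact: measurable_itv.
Qed.

End BorelFunctions.

(** * Potentials vanishing outside the ball *)

Section Potentials.
Context {R : realType} {n : nat}.
Variable rad : R.
Implicit Types (w : borel_rV R n -> R) (x y : 'rV[R]_n).

Local Notation B := (@ecball R n rad : set (borel_rV R n)).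
Local Notation delta i := (delta_mx ord0 i : 'rV[R]_n).

Definition riesz_kernel (m : nat) y : borel_rV R n -> R :=
  fun x => (enorm (y - x))^-1 ^+ m.

Let mB : measurable B. Proof. exact: measurable_ecball. Qed.

Lemma enorm_sub_ge (e : R) x y : B x -> rad + e <= enorm y -> e <= enorm (y - x).
Proof.
rewrite /ecball/= => Bx ey; rewrite (le_trans _ (lerB_enorm _ _))//.
by rewrite lerBrDr (le_trans _ ey)// addrC lerD2r.
Qed.

Lemma enorm_sub_gt0 x y : B x -> rad < enorm y -> 0 < enorm (y - x).
Proof.
move=> Bx ry; rewrite (@lt_le_trans _ _ (enorm y - rad)) ?subr_gt0//.
by apply: (enorm_sub_ge Bx); rewrite addrC subrK.
Qed.

Lemma riesz_kernel_le (e : R) m x y : 0 < e -> B x -> rad + e <= enorm y ->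
  riesz_kernel m y x <= e^-1 ^+ m.
Proof.
move=> e0 Bx ey; rewrite lerXn2r ?nnegrE ?invr_ge0 ?enorm_ge0 ?(ltW e0)//.
have := enorm_sub_ge Bx ey => le.
by rewrite lef_pV2 ?posrE// (lt_le_trans e0).
Qed.

Lemma riesz_kernel_ge0 m y x : 0 <= riesz_kernel m y x.
Proof. by rewrite exprn_ge0// invr_ge0 enorm_ge0. Qed.

Lemma bounded_measurable_coord i :
  bounded_measurable B (fun x => (x : 'rV[R]_n) ord0 i).
Proof.
split; first by apply: measurable_funTS; exact: measurable_coord.
by exists rad => x Bx; rewrite (le_trans (coord_le_enorm _ _)).
Qed.

Lemma measurable_riesz_kernel m y : measurable_fun setT (riesz_kernel m y).
Proof.
apply: measurable_funX.
have := measurableT_comp (measurable_powR (-1 : R)) (measurable_enorm_sub y).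
apply: eq_measurable_fun => x _ /=.
by rewrite powR_inv1// enorm_ge0.
Qed.

Lemma bounded_measurable_riesz m y : rad < enorm y ->
  bounded_measurable B (riesz_kernel m y).
Proof.
move=> ry; split; first by apply: measurable_funTS; exact: measurable_riesz_kernel.
exists ((enorm y - rad)^-1 ^+ m) => x Bx.
rewrite ger0_norm ?riesz_kernel_ge0// riesz_kernel_le ?subr_gt0//.
by rewrite addrC subrK.
Qed.

Variables alpha beta : {measure set (borel_rV R n) -> \bar R}.
Hypotheses (alphaoo : (alpha setT < +oo)%E) (betaoo : (beta setT < +oo)%E).

Definition potential m w y : R :=
  diff_int B alpha beta (fun x => w x * riesz_kernel m y x).

Local Notation coordM i w := (fun x : borel_rV R n => (x : 'rV[R]_n) ord0 i * w x).

Let bounded_coordM i w : bounded_measurable B w ->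
  bounded_measurable B (coordM i w).
Proof. exact: bounded_measurableM (bounded_measurable_coord i). Qed.

Let bounded_integrand m w y : bounded_measurable B w -> rad < enorm y ->
  bounded_measurable B (fun x => w x * riesz_kernel m y x).
Proof.
by move=> bw ry; apply: bounded_measurableM => //; exact: bounded_measurable_riesz.
Qed.

Let enorm_shift y i (t : R) : rad < enorm y ->
  t \in `]- ((enorm y - rad) / 2), ((enorm y - rad) / 2)[ ->
  rad + (enorm y - rad) / 2 <= enorm (y + t *: delta i).
Proof.
move=> ry; rewrite in_itv/= -ltr_norml => td.
have := lerB_enorm y (- (t *: delta i)).
rewrite opprK enormN enormZ enorm_delta mulr1; lra.
Qed.

(** Differentiation under the integral sign. The domination is uniform in x
    because |y_i - x_i| |y - x|^(-1) <= 1 and the remaining powers of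
    |y - x|^(-1) are bounded as long as y stays at positive distance from the
    ball. *)
Lemma is_derive_potential m w y i : bounded_measurable B w -> rad < enorm y ->
  is_derive (0 : R) 1 (fun t : R => potential m w (y + t *: delta i))
    (- m%:R * (y ord0 i * potential m.+2 w y - potential m.+2 (coordM i w) y)).
Proof.
move=> bw ry; have [mw [M wM]] := bw.
(* half the distance from y to the ball: translates of y by less than e stay
   at distance at least e from it *)
set e := (enorm y - rad) / 2; have e0 : 0 < e by rewrite divr_gt0// subr_gt0.
pose df (t : R) (x : borel_rV R n) : R :=
  w x * (- m%:R * ((y - x) ord0 i + t) * riesz_kernel m.+2 (y + t *: delta i) x).
have shiftE t x : y + t *: delta i - x = y - x + t *: delta i by rewrite addrAC.
have shift_gt t : t \in `]- e, e[ -> rad < enorm (y + t *: delta i).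
  by move=> te; rewrite (lt_le_trans _ (enorm_shift _ ry te))// ltrDl.
have -> : - m%:R * (y ord0 i * potential m.+2 w y - potential m.+2 (coordM i w) y) =
    diff_int B alpha beta (df 0).
  have b1 : bounded_measurable B (fun x => w x * riesz_kernel m.+2 y x).
    exact: bounded_integrand.
  have b2 : bounded_measurable B (fun x => coordM i w x * riesz_kernel m.+2 y x).
    by apply: bounded_integrand => //; exact: bounded_coordM.
  rewrite /potential mulrBr mulrA -mulNr -!diff_intZ//.
  rewrite -diff_intD//; last 2 first.
    by apply: bounded_measurableM => //; exact: bounded_measurable_cst.
    by apply: bounded_measurableM => //; exact: bounded_measurable_cst.
  apply: eq_diff_int => x _; rewrite /df scale0r addr0 !mxE addr0.
  by ring.
apply: (@is_derive_diff_int _ _ _ _ mB _ _ alphaoo betaoo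
  (fun t x => w x * riesz_kernel m (y + t *: delta i) x) df (- e) e 0
  (`|M| * (m%:R * e^-1 ^+ m.+1))).
- by rewrite in_itv/= oppr_lt0 e0.
- by move=> t te; apply: bounded_integrand => //; exact: shift_gt.
- move=> t x te Bx.
  have p0 : 0 < enorm (y - x + t *: delta i).
    by rewrite -shiftE enorm_sub_gt0// shift_gt.
  have := is_deriveZ (w x) (is_derive_enorm_inv_pow m p0).
  rewrite /df /riesz_kernel shiftE.
  by under [X in _ -> is_derive _ _ X _]eq_fun do rewrite shiftE.
- move=> t x te Bx.
  have ey := enorm_shift i ry te.
  rewrite normrM ler_pM//; first by rewrite (le_trans (wM x Bx))// ler_norm.
  rewrite -mulrA normrM normrN normr_nat ler_wpM2l// normrM.
  rewrite [X in _ * X]ger0_norm ?riesz_kernel_ge0// /riesz_kernel exprS mulrA.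
  rewrite -[leRHS]mul1r ler_pM ?exprn_ge0 ?mulr_ge0 ?invr_ge0 ?enorm_ge0//; last first.
    exact: (@riesz_kernel_le e m.+1 x).
  rewrite ler_pdivrMr ?mul1r; last by rewrite enorm_sub_gt0// shift_gt.
  rewrite shiftE (le_trans _ (coord_le_enorm _ i))// !mxE eqxx/= eqxx mulr1//.
Qed.

Definition null_potential m w := forall y, rad < enorm y -> potential m w y = 0.

Let potentialD m w1 w2 y : rad < enorm y ->
  bounded_measurable B w1 -> bounded_measurable B w2 ->
  potential m (fun x => w1 x + w2 x) y = potential m w1 y + potential m w2 y.
Proof.
move=> ry b1 b2; rewrite /potential -diff_intD//; try exact: bounded_integrand.
by apply: eq_diff_int => x _; rewrite mulrDl.
Qed.

Let potentialZ m w (c : R) y : rad < enorm y -> bounded_measurable B w ->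
  potential m (fun x => c * w x) y = c * potential m w y.
Proof.
move=> ry bw; rewrite /potential -diff_intZ//; last exact: bounded_integrand.
by apply: eq_diff_int => x _; rewrite mulrA.
Qed.

Let near0_shift y i : rad < enorm y ->
  \forall t \near (0 : R), rad < enorm (y + t *: delta i).
Proof.
move=> ry; have e0 : 0 < (enorm y - rad) / 2 by rewrite divr_gt0// subr_gt0.
near=> t; rewrite (lt_le_trans _ (enorm_shift (t := t) i ry _)) ?ltrDl//.
near: t; apply: near_in_itvoo; rewrite in_itv/=; lra.
Unshelve. all: by end_near. Qed.

Let derive_null (f : R -> R) (d : R) :
  is_derive (0 : R) 1 f d -> (\forall t \near (0 : R), f t = 0) -> d = 0.
Proof.
move=> fd f0.
have [_ <-] := near_eq_is_derive f0 fd.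
exact: derive_cst.
Qed.

(** The gradient of a vanishing potential vanishes; since the kernel has
    gradient - m (y - x) |y - x|^(-m-2), multiplication by x_i under the
    integral then amounts to multiplication by y_i outside. *)
Lemma null_potential_grad m w : (0 < m)%N -> bounded_measurable B w ->
  null_potential m w -> forall i y, rad < enorm y ->
  potential m.+2 (coordM i w) y = y ord0 i * potential m.+2 w y.
Proof.
move=> m0 bw w0 i y ry.
have dP := is_derive_potential m i bw ry.
have f0 : \forall t \near (0 : R), potential m w (y + t *: delta i) = 0.
  by near do apply: w0; exact: near0_shift.
move/eqP: (derive_null dP f0); rewrite mulf_eq0 oppr_eq0 pnatr_eq0 gtn_eqF//= subr_eq0.
by move=> /eqP.
Unshelve. all: by end_near. Qed.

(** Derivative of null_potential_grad in the direction of the i-th axis: the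
    left-hand side comes from the explicit factor y_i, the right-hand side from
    the kernel. *)
Let potential_hessian m w : (0 < m)%N -> bounded_measurable B w ->
  null_potential m w -> forall i y, rad < enorm y ->
  potential m.+2 w y =
  m.+2%:R * potential m.+4 (fun x => (y ord0 i - (x : 'rV[R]_n) ord0 i) ^+ 2 * w x) y.
Proof.
move=> m0 bw w0 i y ry.
pose xw := coordM i w; have bxw : bounded_measurable B xw by exact: bounded_coordM.
have bxxw : bounded_measurable B (coordM i xw) by exact: bounded_coordM.
have dw := is_derive_potential m.+2 i bw ry.
have dxw := is_derive_potential m.+2 i bxw ry.
have dy : is_derive (0 : R) 1 (cst (y ord0 i) + @id R) 1.
  by apply: is_derive_eq (is_deriveD (is_derive_cst _ _ _) (is_derive_id _ _)) _; rewrite add0r.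
have d0 := is_deriveB (is_deriveM dy dw) dxw.
have f0 : \forall t \near (0 : R),
    ((cst (y ord0 i) + @id R) * (fun t => potential m.+2 w (y + t *: delta i)) -
     (fun t => potential m.+2 xw (y + t *: delta i))) t = 0.
  have near0 := near0_shift i ry.
  near=> t; have rt : rad < enorm (y + t *: delta i) by near: t.
  rewrite !fctE /= (null_potential_grad m0 bw w0 i rt) !mxE !eqxx/= mulr1.
  by rewrite subrr.
have /eqP := derive_null d0 f0.
rewrite !fctE/= scale0r /GRing.scale/= !addr0 mulr1 -/xw.
have -> : potential m.+4 (fun x => (y ord0 i - (x : 'rV[R]_n) ord0 i) ^+ 2 * w x) y =
    y ord0 i ^+ 2 * potential m.+4 w y + (- 2 * y ord0 i) * potential m.+4 xw y
    + potential m.+4 (coordM i xw) y.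
  have bc (c : R) w' : bounded_measurable B w' -> bounded_measurable B (fun x => c * w' x).
    by apply: bounded_measurableM; exact: bounded_measurable_cst.
  rewrite -!potentialZ// -potentialD//; [|exact: bc..].
  rewrite -potentialD//; last by apply: bounded_measurableD; exact: bc.
  by apply: eq_diff_int => x _; rewrite /xw; ring.
move: (m.+2%:R : R) => k /eqP d0E; apply/eqP; rewrite -subr_eq0 -[0]d0E; apply/eqP.
ring.
Unshelve. all: by end_near. Qed.

(** Summing potential_hessian over i produces |y - x|^2, which lowers the
    exponent m + 4 to m + 2, so the potential equals (m + 2) / n times itself.
    The excluded case m + 2 = n is genuine: there the kernel with exponent
    n - 2 is harmonic in y, and its Laplacian carries no information. *)
Lemma null_potential_succ m w : (0 < m)%N -> m.+2 != n -> bounded_measurable B w ->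
  null_potential m w -> null_potential m.+2 w.
Proof.
move=> m0 mn bw w0 y ry.
have bsq i : bounded_measurable B (fun x => (y ord0 i - (x : 'rV[R]_n) ord0 i) ^+ 2 * w x).
  apply: bounded_measurableM => //; under eq_fun do rewrite expr2.
  have b1 : bounded_measurable B (fun x => y ord0 i - (x : 'rV[R]_n) ord0 i).
    under eq_fun do rewrite -mulN1r.
    apply: bounded_measurableD; first exact: bounded_measurable_cst.
    apply: bounded_measurableM; first exact: bounded_measurable_cst.
    exact: bounded_measurable_coord.
  exact: bounded_measurableM.
have : \sum_(i < n) potential m.+2 w y = m.+2%:R * potential m.+2 w y.
  under eq_bigr => i _ do rewrite (potential_hessian m0 bw w0 i ry).
  rewrite -mulr_sumr -diff_int_sum//; last first.
    by move=> i; exact: bounded_integrand.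
  congr (_ * _); apply: eq_diff_int => x; rewrite inE => Bx.
  rewrite -mulr_suml -mulr_suml.
  rewrite (eq_bigr (fun i => (y - x) ord0 i ^+ 2)); last by move=> i _; rewrite !mxE.
  rewrite -sqr_enorm /riesz_kernel (exprS _ m.+3) (exprS _ m.+2).
  have := enorm_sub_gt0 Bx ry; move: (enorm (y - x)) => s s0.
  field; rewrite gt_eqF//.
rewrite sumr_const card_ord -[LHS]mulr_natl => /eqP.
rewrite -subr_eq0 -mulrBl mulf_eq0 subr_eq0 eqr_nat eq_sym (negbTE mn)/=.
by move=> /eqP.
Qed.

Lemma null_potential_coord m w i : (0 < m)%N -> m.+2 != n -> bounded_measurable B w ->
  null_potential m w -> null_potential m.+2 (coordM i w).
Proof.
move=> m0 mn bw w0 y ry.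
by rewrite (null_potential_grad m0 bw w0 i ry) (null_potential_succ m0 mn bw w0 ry) mulr0.
Qed.

End Potentials.

(** * Polynomials converging to the indicator of a half-line *)

Section StepPolynomials.
Context {R : realType}.
Implicit Types (a u t c : R).

Lemma bernoulli_ineq a N : -1 <= a -> 1 + N%:R * a <= (1 + a) ^+ N.
Proof.
move=> a1; elim: N => [|N ih]; first by rewrite mul0r addr0 expr0.
have a0 : 0 <= 1 + a by lra.
rewrite exprS (le_trans _ (ler_wpM2l a0 ih))//.
have : 0 <= N%:R * a ^+ 2 by rewrite mulr_ge0 ?sqr_ge0.
rewrite -natr1; lra.
Qed.

Lemma expr1B_le a N : 0 <= a <= 1 -> (1 - a) ^+ N * (1 + N%:R * a) <= 1.
Proof.
move=> /andP[a0 a1].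
have b0 : 0 <= 1 - a by lra.
rewrite (@le_trans _ _ ((1 - a) ^+ N * (1 + a) ^+ N))//.
  by rewrite ler_wpM2l ?exprn_ge0// bernoulli_ineq//; lra.
rewrite -exprMn exprn_ile1//; first by rewrite mulr_ge0//; lra.
have := sqr_ge0 a; lra.
Qed.

Lemma cvg_natr_mul_expr a : 0 <= a < 1 -> (k%:R * a ^+ k) @[k --> \oo] --> (0 : R).
Proof.
move=> /andP[a0 a1].
have [->|an0] := eqVneq a 0.
  apply: cvg_near_cst; near=> k; rewrite expr0n gtn_eqF ?mulr0//.
  by near: k; exact: nbhs_infty_gt.
have ap : 0 < a by rewrite lt0r an0.
pose y := Num.sqrt a; have y0 : 0 < y by rewrite sqrtr_gt0.
have yE : y ^+ 2 = a by rewrite sqr_sqrtr.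
have y1 : y < 1 by rewrite -(@ltr_pXn2r _ 2) ?nnegrE ?(ltW y0)// yE expr1n.
(* Bernoulli applied to y^-1 bounds k y^k, the other factor y^k tends to 0 *)
pose b := y^-1 - 1; have b0 : 0 < b by rewrite subr_gt0 invf_gt1.
have ky k : k%:R * y ^+ k <= b^-1.
  have := @bernoulli_ineq b k; rewrite /b addrCA subrr addr0 -/b.
  move=> /(_ (ltW (lt_trans (ltrN10 _) b0))) h.
  rewrite -(ler_pM2r b0) mulVf ?gt_eqF// mulrAC.
  rewrite -ler_pdivlMr ?exprn_gt0// mul1r -exprVn (le_trans _ h)// lerDr//.
apply: (@squeeze_cvgr _ _ _ _ (fun=> 0) (fun k => b^-1 * y ^+ k)).
- apply: nearW => k; rewrite mulr_ge0 ?exprn_ge0//= -yE -exprM mulnC exprM expr2.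
  by rewrite mulrA ler_wpM2r ?exprn_ge0// ltW.
- exact: cvg_cst.
- rewrite -[X in _ --> X](mulr0 b^-1); apply: cvgMr.
  by apply: cvg_expr; rewrite ger0_norm ?ltW.
Unshelve. all: by end_near. Qed.

(** With N = k 2^k one has N u^k = k (2u)^k, which tends to 0 for u < 1/2 and is
    at least k for u >= 1/2. The extra factor k in N is what sends the value at
    u = 1/2 to 0; with N = 2^k it would tend to 1/e. *)
Lemma cvg_half_step u : 0 <= u <= 1 ->
  ((1 - u ^+ k) ^+ (k * 2 ^ k)) @[k --> \oo] --> ((u < 2^-1)%R%:R : R).
Proof.
move=> /andP[u0 u1].
have uk k : 0 <= u ^+ k <= 1 by rewrite exprn_ge0// exprn_ile1.
have q0 k : 0 <= (1 - u ^+ k) ^+ (k * 2 ^ k).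
  by rewrite exprn_ge0// subr_ge0; case/andP: (uk k).
have NE k : (k * 2 ^ k)%:R * u ^+ k = k%:R * (2 * u) ^+ k.
  by rewrite natrM natrX -mulrA -exprMn.
have [ulth|uge] := ltP u 2^-1.
  apply: (@squeeze_cvgr _ _ _ _ (fun k => 1 - k%:R * (2 * u) ^+ k) (fun=> 1)).
  - apply: nearW => k; rewrite exprn_ile1 ?andbT; first last.
      by rewrite lerBlDr lerDl exprn_ge0.
      by rewrite subr_ge0; case/andP: (uk k).
    rewrite -NE (le_trans _ (@bernoulli_ineq _ _ _)) ?mulrN//.
    by rewrite lerN2; case/andP: (uk k).
  - rewrite -[X in _ --> X](subr0 (1 : R)); apply: cvgB; first exact: cvg_cst.
    apply: cvg_natr_mul_expr; lra.
  - exact: cvg_cst.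
apply: (@squeeze_cvgr _ _ _ _ (fun=> 0) harmonic).
- apply: nearW => k; rewrite q0/=.
  rewrite -[leRHS]mul1r ler_pdivlMr// (le_trans _ (expr1B_le (k * 2 ^ k) (uk k)))//.
  rewrite ler_wpM2l// NE -natr1 addrC lerD2l ler_peMr//.
  by rewrite exprn_ege1//; lra.
- exact: cvg_cst.
- exact: cvg_harmonic.
Qed.

(* The affine map sends [-r, r] into [0, 1] and c to 1/2. *)
Definition step_poly (r c : R) (k : nat) : {poly R} :=
  (1 - ((2^-1)%:P + (2 * (r + `|c| + 1))^-1 *: ('X - c%:P)) ^+ k) ^+ (k * 2 ^ k).

Let affine_itv (r c t : R) : `|t| <= r ->
  0 <= 2^-1 + (2 * (r + `|c| + 1))^-1 * (t - c) <= 1.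
Proof.
move=> tr; set D := r + _ + 1.
have r0 : 0 <= r by rewrite (le_trans _ tr).
have D0 : 0 < D by rewrite ltr_pwDr// addr_ge0.
have : `|t - c| <= D by rewrite (le_trans (ler_normB _ _))// /D; lra.
rewrite invfM -mulrA; set v := D^-1 * _ => tcD.
have : `|v| <= 1.
  by rewrite normrM gtr0_norm ?invr_gt0// mulrC ler_pdivrMr// mul1r.
by rewrite ler_norml => /andP[]; lra.
Qed.

Let step_polyE r c k t : (step_poly r c k).[t] =
  (1 - (2^-1 + (2 * (r + `|c| + 1))^-1 * (t - c)) ^+ k) ^+ (k * 2 ^ k).
Proof. by rewrite /step_poly !hornerE. Qed.

Lemma step_poly_itv r c k t : `|t| <= r -> 0 <= (step_poly r c k).[t] <= 1.
Proof.
move=> /(affine_itv c)/andP[u0 u1]; rewrite step_polyE.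
move: (_ + _) u0 u1 => u u0 u1.
have v0 : 0 <= 1 - u ^+ k by rewrite subr_ge0 exprn_ile1.
by rewrite exprn_ge0// exprn_ile1// lerBlDr lerDl exprn_ge0.
Qed.

Lemma cvg_step_poly r c t : `|t| <= r ->
  (step_poly r c k).[t] @[k --> \oo] --> ((t < c)%R%:R : R).
Proof.
move=> tr; under eq_fun do rewrite step_polyE.
have -> : (t < c) = (2^-1 + (2 * (r + `|c| + 1))^-1 * (t - c) < 2^-1).
  rewrite gtrDl pmulr_rlt0 ?subr_lt0// invr_gt0 mulr_gt0//.
  by rewrite ltr_pwDr// addr_ge0// (le_trans _ tr).
by apply: cvg_half_step; exact: affine_itv.
Qed.

End StepPolynomials.

(** * From vanishing potentials to vanishing moments *)

Section Moments.
Context {R : realType} {n : nat}.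
Variable rad : R.
Implicit Types (w : borel_rV R n -> R) (x y : 'rV[R]_n).

Local Notation B := (@ecball R n rad : set (borel_rV R n)).

Let mB : measurable B. Proof. exact: measurable_ecball. Qed.

Variables alpha beta : {measure set (borel_rV R n) -> \bar R}.
Hypotheses (alphaoo : (alpha setT < +oo)%E) (betaoo : (beta setT < +oo)%E).
Hypotheses (n_gt0 : (0 < n)%N) (rad_gt0 : 0 < rad).

Local Notation null_potential := (null_potential rad alpha beta).

(** Moments as limits at infinity: along y = rho e_0 with rho tending to
    infinity, rho^m |y - x|^(-m) tends to 1, and it is at most 2^m on the ball
    once rho >= 2 rad. *)
Lemma null_potential_diff_int m w : bounded_measurable B w ->
  null_potential m w -> diff_int B alpha beta w = 0.
Proof.
move=> [mw [M wM]] w0.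
pose i0 : 'I_n := Ordinal n_gt0.
(* the summand 2 rad keeps every rho k in the range of the bound 2^m *)
pose rho (k : nat) : R := 2 * rad + k.+1%:R.
pose y k : 'rV[R]_n := rho k *: delta_mx ord0 i0.
have rho0 k : 0 < rho k by rewrite ltr_wpDl// mulr_ge0// ltW.
have yE k : enorm (y k) = rho k by rewrite enormZ enorm_delta mulr1 gtr0_norm.
have ry k : rad < enorm (y k).
  by rewrite yE /rho mulr_natl mulr2n -addrA ltrDl addr_gt0.
pose f k (x : borel_rV R n) := w x * (rho k * (enorm (y k - x))^-1) ^+ m.
have fE k : f k = (fun x => rho k ^+ m * (w x * riesz_kernel m (y k) x)).
  by apply/funext => x; rewrite /f exprMn mulrCA.
have f0 k : diff_int B alpha beta (f k) = 0.
  rewrite fE diff_intZ//; last first.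
    apply: bounded_measurableM; first by split => //; exists M.
    by apply: bounded_measurable_riesz.
  by rewrite -/(potential rad alpha beta m w (y k)) w0// mulr0.
have cvgf : diff_int B alpha beta (f k) @[k --> \oo] --> diff_int B alpha beta w.
  apply: (@diff_int_cvg _ _ _ _ mB _ _ alphaoo betaoo _ _ (`|M| * 2 ^+ m)).
  - move=> k; rewrite fE; apply: measurable_funM => //.
    apply: measurable_funM => //; apply: measurable_funTS.
    exact: measurable_riesz_kernel.
  - move=> k x Bx; rewrite normrM ler_pM//.
      by rewrite (le_trans (wM x Bx))// ler_norm.
    rewrite ger0_norm ?exprn_ge0 ?mulr_ge0 ?invr_ge0 ?enorm_ge0 ?(ltW (rho0 k))//.
    rewrite lerXn2r ?nnegrE ?mulr_ge0 ?invr_ge0 ?enorm_ge0 ?(ltW (rho0 k))//.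
    rewrite ler_pdivrMr ?(enorm_sub_gt0 Bx)//.
    have := @enorm_sub_ge _ _ rad (rho k - rad) x (y k) Bx.
    rewrite yE addrC subrK lexx => /(_ isT).
    have : 2 * rad <= rho k by rewrite lerDl.
    by move: (enorm _) (rho k) => s r; lra.
  - move=> x Bx; rewrite /f.
    have cvg1 : (rho k)^-1 * enorm (y k - x) @[k --> \oo] --> (1 : R).
      apply/subr_cvg0; apply/norm_cvg0P.
      apply: (@squeeze_cvgr _ _ _ _ (fun=> 0) (fun k => rad * harmonic k)).
      + apply: nearW => k; rewrite normr_ge0/=.
        have -> : (rho k)^-1 * enorm (y k - x) - 1 =
            (rho k)^-1 * (enorm (y k - x) - rho k).
          by rewrite mulrBr mulVf// gt_eqF.
        rewrite normrM gtr0_norm ?invr_gt0// mulrC ler_pM ?invr_ge0 ?(ltW (rho0 k))//.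
          rewrite ler_distl -yE; apply/andP; split.
            by rewrite (le_trans _ (lerB_enorm _ _))// lerD2l lerN2.
          by rewrite (le_trans (ler_enormD _ _))// enormN lerD2l.
        by rewrite lef_pV2 ?posrE// /rho lerDr mulr_ge0// ltW.
      + exact: cvg_cst.
      + by rewrite -[X in _ --> X](mulr0 rad); apply: cvgMr; exact: cvg_harmonic.
    have -> : (fun k => w x * (rho k * (enorm (y k - x))^-1) ^+ m) =
        (fun k => w x * (((rho k)^-1 * enorm (y k - x))^-1) ^+ m).
      by apply/funext => k; rewrite invfM invrK.
    rewrite -[X in _ --> X]mulr1; apply: cvgMr.
    have cvgV1 : ((rho k)^-1 * enorm (y k - x))^-1 @[k --> \oo] --> (1 : R).
      by rewrite -[X in _ --> X]invr1; apply: cvgV => //; exact: oner_neq0.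
    rewrite -[X in _ --> X](expr1n R m).
    exact: (@continuous_cvg _ _ _ _ _ _ (fun z : R => z ^+ m) _ (@exprn_continuous _ m 1) cvgV1).
have : diff_int B alpha beta (f k) @[k --> \oo] --> (0 : R).
  by under eq_fun do rewrite f0; exact: cvg_cst.
exact: (cvg_unique _ cvgf).
Qed.

(** The exponent n + 2d is left free: multiplication by a coordinate raises it,
    and two functions are added after raising both exponents to a common
    value. *)
Definition annihilated w := bounded_measurable B w /\
  exists d, null_potential (n + d.*2) w.

Lemma annihilated_diff_int w : annihilated w -> diff_int B alpha beta w = 0.
Proof. by move=> [bw [d]]; exact: null_potential_diff_int. Qed.

Let null_potential_add d e w : bounded_measurable B w ->
  null_potential (n + d.*2) w -> null_potential (n + (d + e).*2) w.
Proof.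
move=> bw w0; elim: e => [|e ih]; first by rewrite addn0.
rewrite addnS doubleS !addnS; apply: null_potential_succ => //.
  by rewrite addn_gt0 n_gt0.
by rewrite neq_ltn !ltnS leqW ?leq_addr ?orbT.
Qed.

Lemma annihilatedD w1 w2 : annihilated w1 -> annihilated w2 ->
  annihilated (fun x => w1 x + w2 x).
Proof.
move=> [b1 [d1 h1]] [b2 [d2 h2]]; split; first exact: bounded_measurableD.
exists (d1 + d2)%N => y ry.
have k1 := null_potential_add d2 b1 h1; have k2 := null_potential_add d1 b2 h2.
rewrite (addnC d2) in k2.
have bk := bounded_measurable_riesz (n + (d1 + d2).*2) ry.
transitivity (potential rad alpha beta (n + (d1 + d2).*2) w1 y +
              potential rad alpha beta (n + (d1 + d2).*2) w2 y).
  rewrite /potential -diff_intD//; try exact: bounded_measurableM.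
  by apply: eq_diff_int => x _; rewrite mulrDl.
by rewrite k1// k2// addr0.
Qed.

Lemma annihilatedZ c w : annihilated w -> annihilated (fun x => c * w x).
Proof.
move=> [bw [d wd]]; split.
  by apply: bounded_measurableM => //; exact: bounded_measurable_cst.
exists d => y ry; rewrite /potential.
have bk := bounded_measurable_riesz (n + d.*2) ry.
transitivity (c * potential rad alpha beta (n + d.*2) w y).
  rewrite /potential -diff_intZ//; last exact: bounded_measurableM.
  by apply: eq_diff_int => x _; rewrite mulrA.
by rewrite wd// mulr0.
Qed.

Lemma annihilated_coord i w : annihilated w ->
  annihilated (fun x => (x : 'rV[R]_n) ord0 i * w x).
Proof.
move=> [bw [d wd]]; split.
  exact: bounded_measurableM (bounded_measurable_coord _ _) bw.
exists d.+1; rewrite doubleS !addnS; apply: null_potential_coord => //.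
  by rewrite addn_gt0 n_gt0.
by rewrite neq_ltn !ltnS leqW ?leq_addr ?orbT.
Qed.

Lemma annihilated_poly i (p : {poly R}) w : annihilated w ->
  annihilated (fun x => p.[(x : 'rV[R]_n) ord0 i] * w x).
Proof.
elim/poly_ind: p w => [|p c ih] w aw.
  by under eq_fun do rewrite horner0; exact: annihilatedZ.
under eq_fun do rewrite hornerMXaddC mulrDl -mulrA.
by apply: annihilatedD; [apply: ih; exact: annihilated_coord|exact: annihilatedZ].
Qed.

Hypothesis null1 : null_potential n (fun=> 1).

Lemma annihilated_prod_poly (p : 'I_n -> {poly R}) :
  annihilated (fun x => \prod_(i < n) (p i).[(x : 'rV[R]_n) ord0 i]).
Proof.
have a1 : annihilated (fun=> 1).
  by split; [exact: bounded_measurable_cst|exists 0%N; rewrite addn0].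
elim: (index_enum _) => [|i s ih]; first by under eq_fun do rewrite big_nil.
by under eq_fun do rewrite big_cons; exact: annihilated_poly.
Qed.

Definition box (a b : 'rV[R]_n) : set (borel_rV R n) :=
  [set x | forall i, a ord0 i <= (x : 'rV[R]_n) ord0 i < b ord0 i].

(** The indicator of a box is a bounded pointwise limit of polynomials: each
    one-sided constraint is the limit of a step polynomial. *)
Lemma diff_int_box a b : diff_int B alpha beta (\1_(box a b)) = 0.
Proof.
pose p k i := step_poly rad (b ord0 i) k * (1 - step_poly rad (a ord0 i) k).
pose f k (x : borel_rV R n) := \prod_(i < n) (p k i).[(x : 'rV[R]_n) ord0 i].
have f0 k : diff_int B alpha beta (f k) = 0.
  by apply: annihilated_diff_int; exact: annihilated_prod_poly.
have xr x i : B x -> `|x ord0 i| <= rad.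
  by move=> Bx; rewrite (le_trans (coord_le_enorm _ _)).
have pE k i x : (p k i).[x ord0 i] =
    (step_poly rad (b ord0 i) k).[x ord0 i] * (1 - (step_poly rad (a ord0 i) k).[x ord0 i]).
  by rewrite !hornerE.
have : diff_int B alpha beta (f k) @[k --> \oo] --> diff_int B alpha beta (\1_(box a b)).
  apply: (@diff_int_cvg _ _ _ _ mB _ _ alphaoo betaoo _ _ 1).
  - by move=> k; have [[]] := annihilated_prod_poly (p k).
  - move=> k x Bx; rewrite normr_prod.
    apply: prodr_ile1 => i _; rewrite normr_ge0/=.
    rewrite pE normrM.
    have /andP[s0 s1] := step_poly_itv (b ord0 i) k (xr x i Bx).
    have /andP[t0 t1] := step_poly_itv (a ord0 i) k (xr x i Bx).
    by rewrite -[leRHS]mulr1 ler_pM// ler_norml; apply/andP; split; lra.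
  - move=> x Bx.
    have -> : \1_(box a b) x = \prod_(i < n)
        ((x ord0 i < b ord0 i)%R%:R * (1 - (x ord0 i < a ord0 i)%R%:R)) :> R.
      rewrite indicE; case: (boolP (x \in box a b)); rewrite ?inE => xab.
        rewrite big1// => i _; have /andP[ax ->] := xab i.
        by rewrite ltNge ax subr0 mulr1.
      have /existsNP[i /negP] : ~ box a b x by move: xab; rewrite notin_setE.
      rewrite negb_and -!ltNge => h; rewrite (bigD1 i)//=.
      case/orP: h => [->|]; first by rewrite subrr mulr0 mul0r.
      by move=> /negbTE ->; rewrite !mul0r.
    rewrite /f; elim: (index_enum _) => [|i s ih].
      by under eq_fun do rewrite big_nil; rewrite big_nil; exact: cvg_cst.
    under eq_fun do rewrite big_cons; rewrite big_cons; apply: cvgM => //.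
    under eq_fun do rewrite pE.
    apply: cvgM; first by apply: cvg_step_poly; exact: xr.
    by apply: cvgB; [exact: cvg_cst|apply: cvg_step_poly; exact: xr].
under eq_fun do rewrite f0.
by move=> /(cvg_unique (@Rhausdorff R)); apply; exact: cvg_cst.
Qed.

End Moments.

(** * Boxes with rational corners *)

Section RationalBoxes.
Context {R : realType} {n : nat}.

Definition rat_box (q : 'rV[rat]_n * 'rV[rat]_n) : set (borel_rV R n) :=
  box (map_mx ratr q.1) (map_mx ratr q.2).

Lemma nbhs_rat_box (x : 'rV[R]_n) (U : set 'rV[R]_n) : open U -> U x ->
  exists q, rat_box q x /\ rat_box q `<=` U.
Proof.
move=> oU Ux; have /nbhs_ballP[e /= e0 eU] : nbhs x U by exact: open_nbhs_nbhs.
have ab i : exists ab : rat * rat, x ord0 i - e < ratr ab.1 /\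
    [/\ ratr ab.1 <= x ord0 i, x ord0 i < ratr ab.2 & ratr ab.2 < x ord0 i + e].
  have /rat_in_itvoo[a] : x ord0 i - e < x ord0 i by rewrite ltrBlDr ltrDl.
  have /rat_in_itvoo[b] : x ord0 i < x ord0 i + e by rewrite ltrDl.
  rewrite !in_itv/= => /andP[b1 b2] /andP[a1 a2].
  by exists (a, b); split => //; split => //; exact: ltW.
have [c cP] := choice ab.
exists (\row_i (c i).1, \row_i (c i).2); split => [i|y yb].
  by rewrite !mxE/=; have [_ [-> ->]] := cP i.
apply: eU; split => // i j; rewrite ord1 /ball/=.
have [c1 [c2 c3 c4]] := cP j; have := yb j; rewrite !mxE/= => /andP[y1 y2].
rewrite ltr_distlC; apply/andP; split.
  by rewrite (lt_le_trans c1).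
by rewrite (lt_trans y2).
Qed.

Lemma measurable_box (a b : 'rV[R]_n) : measurable (box a b).
Proof.
have -> : box a b = \bigcap_(i in [set: 'I_n])
    (setT `&` (fun x : borel_rV R n => (x : 'rV[R]_n) ord0 i) @^-1`
       `[a ord0 i, b ord0 i[).
  apply/seteqP; split => x /= xab.
    by move=> i _; split => //=; rewrite in_itv/= xab.
  by move=> i; have [_] := xab i I; rewrite /= in_itv.
apply: fin_bigcap_measurable => // i _.
by apply: measurable_coord => //; exact: measurable_itv.
Qed.

(** An open set is the union of the countably many rational boxes inside it. *)
Lemma borel_rV_boxes : @measurable _ (borel_rV R n) =
  <<s [set A | exists a b, A = box a b] >>.
Proof.
apply/seteqP; split; last first.
  apply: smallest_sub; first exact: sigma_algebra_measurable.
  by move=> _ [a [b ->]]; exact: measurable_box.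
apply: smallest_sub; first exact: smallest_sigma_algebra.
move=> U oU.
pose V q : set (borel_rV R n) := if `[< rat_box q `<=` U >] then rat_box q else set0.
have -> : U = \bigcup_q V q.
  apply/seteqP; split => [x /(nbhs_rat_box oU)[q [qx qU]]|x [q _]].
    by exists q => //; rewrite /V; case: asboolP.
  by rewrite /V; case: asboolP => // qU /qU.
pose G := [set A : set (borel_rV R n) | exists a b, A = box a b].
apply: (@countable_bigcupT_measurable _ (g_sigma_algebraType G)).
  exact: countableP.
move=> q; rewrite /V; case: asboolP => _; last exact: measurable0.
by apply: sub_sigma_algebra; exists (map_mx ratr q.1), (map_mx ratr q.2).
Qed.

(** Null neighbourhoods can be shrunk to rational boxes, of which there are
    countably many. *)
Lemma locally_null_measure0 (m : {measure set (borel_rV R n) -> \bar R})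
    (A : set (borel_rV R n)) : measurable A ->
  (forall x, A x -> exists U : set 'rV[R]_n, [/\ open U, U x & m U = 0]) ->
  m A = 0.
Proof.
move=> mA null.
pose V (k : nat) : set (borel_rV R n) :=
  if unpickle k is Some q then if m (rat_box q) == 0 then rat_box q else set0
  else set0.
apply: measure_negligible => //; apply: (@negligibleS _ _ _ _ (\bigcup_k V k)).
  move=> x /null[U [oU Ux U0]]; have [q [qx qU]] := nbhs_rat_box oU Ux.
  exists (pickle q) => //; rewrite /V pickleK ifT//.
  rewrite eq_le measure_ge0 andbT -U0; apply: le_measure; rewrite ?inE//.
    exact: measurable_box.
  exact: sub_sigma_algebra.
apply: negligible_bigcup => k; rewrite /V.
case: unpickle => [q|]; last exact: negligible_set0.
case: ifPn => [/eqP m0|_]; last exact: negligible_set0.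
by apply/negligibleP => //; exact: measurable_box.
Qed.

Lemma boxI (a b c d : 'rV[R]_n) :
  box a b `&` box c d =
  box (\row_i Num.max (a ord0 i) (c ord0 i)) (\row_i Num.min (b ord0 i) (d ord0 i)).
Proof.
apply/seteqP; split => [x [xab xcd] i|x xabcd].
  rewrite !mxE ge_max lt_min.
  have /andP[ax xb] := xab i; have /andP[cx xd] := xcd i.
  by apply/andP; split; apply/andP.
split=> i; have := xabcd i; rewrite !mxE ge_max lt_min;
  by move=> /andP[/andP[? ?] /andP[? ?]]; apply/andP.
Qed.

Lemma eq_measure_boxes (m1 m2 : {measure set (borel_rV R n) -> \bar R}) :
  (m1 setT < +oo)%E -> (forall a b, m1 (box a b) = m2 (box a b)) ->
  forall A, measurable A -> m1 A = m2 A.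
Proof.
move=> m1oo m12.
pose g (k : nat) : set (borel_rV R n) := box (const_mx (- k%:R)) (const_mx k%:R).
apply: (measure_unique [set A | exists a b, A = box a b] g).
- exact: borel_rV_boxes.
- by move=> _ _ [a [b ->]] [c [d ->]]; rewrite boxI; do 2 eexists.
- by move=> k; do 2 eexists.
- apply/seteqP; split => // x _.
  pose r := \sum_i `|(x : 'rV[R]_n) ord0 i|.
  exists (Num.truncn r).+1 => // i; rewrite !mxE.
  have rlt : r < (Num.truncn r).+1%:R by rewrite truncnS_gt.
  have xi : `|(x : 'rV[R]_n) ord0 i| <= r.
    by rewrite /r (bigD1 i)//= lerDl sumr_ge0.
  move: (le_lt_trans xi rlt); rewrite ltr_norml => /andP[/ltW -> ->//].
- by move=> _ [a [b ->]]; exact: m12.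
- move=> k; rewrite (le_lt_trans _ m1oo)//; apply: le_measure; rewrite ?inE//.
  exact: measurable_box.
Qed.

End RationalBoxes.

(** * Uniqueness for positive measures *)

(** As both measures live on the ball, the integrals of a box indicator over
    the ball are the measures of the box, and diff_int_box applies. *)
Theorem eq_measure_riesz (R : realType) (n : nat) (rad : R)
    (alpha beta : {measure set (borel_rV R n) -> \bar R}) :
  (0 < n)%N -> 0 < rad ->
  (alpha setT < +oo)%E -> (beta setT < +oo)%E ->
  alpha (~` ecball rad) = 0 -> beta (~` ecball rad) = 0 ->
  (forall y : 'rV[R]_n, rad < enorm y ->
    (\int[alpha]_(x in @ecball R n rad) (enorm (y - x))^-1 ^+ n =
     \int[beta]_(x in @ecball R n rad) (enorm (y - x))^-1 ^+ n)%R) ->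
  forall A, measurable A -> alpha A = beta A.
Proof.
move=> n0 rad0 aoo boo a0 b0 eqint.
have mB := @measurable_ecball R n rad.
apply: eq_measure_boxes => // a b.
have null1 : null_potential rad alpha beta n (fun=> 1).
  move=> y ry; rewrite /potential /diff_int /riesz_kernel.
  by under eq_Rintegral do rewrite mul1r; under [X in _ - X]eq_Rintegral do rewrite mul1r;
    rewrite eqint// subrr.
have := diff_int_box aoo boo n0 rad0 null1 a b.
have inB (m : {measure set (borel_rV R n) -> \bar R}) :
    (m setT < +oo)%E -> m (~` ecball rad) = 0 ->
    m (box a b) = (\int[m]_(x in @ecball R n rad) \1_(box a b) x)%R%:E.
  move=> moo m0.
  have mlt C : measurable C -> (m C < +oo)%E.
    by move=> mC; rewrite (le_lt_trans _ moo)// le_measure ?inE.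
  rewrite /Rintegral integral_indic//; last exact: measurable_box.
  have mb := @measurable_box R n a b.
  rewrite fineK; last by rewrite ge0_fin_numE ?mlt//; exact: measurableI.
  rewrite -[in LHS](setIT (box a b)) -(setUv (@ecball R n rad : set (borel_rV R n))) setIUr.
  rewrite measureU//; last by rewrite setIACA setICr setI0.
  - rewrite [X in (_ + X)%E](_ : _ = 0) ?adde0//.
    apply/eqP; rewrite eq_le measure_ge0 andbT -m0 le_measure ?inE//.
      by apply: measurableI => //; exact: measurableC.
    exact: measurableC.
  - exact: measurableI.
  - by apply: measurableI => //; exact: measurableC.
move=> /subr0_eq ab; rewrite (inB alpha)// (inB beta)//.
by congr (_%:E).
Qed.

(** * The area of the unit sphere is a positive real number *)

Section SphereArea.
Context {R : realType}.
Local Open Scope ereal_scope.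

Lemma lebesgue_iint_ge0 n (f : 'rV[R]_n -> \bar R) :
  (forall x, 0 <= f x) -> 0 <= lebesgue_iint f.
Proof.
elim: n f => [|n ih] f f0 //=.
by apply: integral_ge0 => t _; apply: ih.
Qed.

(** The inner iterated integrals of an arbitrary nonnegative function need not
    be measurable; monotonicity holds nevertheless, because the integral of a
    nonnegative function is a supremum over the simple functions below it. *)
Lemma le_lebesgue_iint n (f g : 'rV[R]_n -> \bar R) :
  (forall x, 0 <= f x) -> (forall x, f x <= g x) ->
  lebesgue_iint f <= lebesgue_iint g.
Proof.
elim: n f g => [|n ih] f g f0 fg //=.
have g0 x : 0 <= g x := le_trans (f0 x) (fg x).
rewrite !ge0_integralTE; try by move=> t; exact: lebesgue_iint_ge0.
apply: ge_ereal_sup => _ [h/= hf <-]; apply: ereal_sup_ubound; exists h => //= t.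
by rewrite (le_trans (hf t))//; exact: ih.
Qed.

Lemma lebesgue_iint0 n : lebesgue_iint (fun _ : 'rV[R]_n => 0) = 0.
Proof.
by elim: n => [//|n ih] /=; under eq_integral do rewrite ih; rewrite integral0.
Qed.

Definition cube n (a b : R) : set 'rV[R]_n :=
  [set x | forall i, (a <= x ord0 i <= b)%R].

Lemma indic_cube_row_mx n (a b t : R) (v : 'rV[R]_n) :
  \1_(@cube n.+1 a b) (row_mx (t%:M : 'rV[R]_1) v) =
  (\1_(`[a, b]%classic) t * \1_(@cube n a b) v)%R :> R.
Proof.
rewrite !indicE -natrM mulnb; congr ((nat_of_bool _)%:R).
apply/idP/andP; rewrite !inE /=.
  move=> h; split.
    have := h (lshift n (ord0 : 'I_1)).
    by rewrite (@row_mxEl _ 1 1 n) mxE eqxx mulr1n in_itv.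
  by move=> i; have := h (rshift 1 i); rewrite (@row_mxEr _ 1 1 n).
move=> [ht hv] i; rewrite -(@fintype.splitK 1%N n i); case: (@fintype.split 1%N n i) => j /=.
  by rewrite (@row_mxEl _ 1 1 n) (ord1 j) mxE eqxx mulr1n; rewrite in_itv in ht.
by rewrite (@row_mxEr _ 1 1 n).
Qed.

Lemma lebesgue_vol_cube n (a b : R) : (a < b)%R ->
  lebesgue_vol (@cube n a b) = ((b - a) ^+ n)%:E.
Proof.
move=> ab; rewrite /lebesgue_vol; elim: n => [|n ih] /=.
  by rewrite indicE mem_set ?expr0// => -[].
transitivity (\int[lebesgue_measure]_(t in [set: R])
    (((b - a) ^+ n)%:E * (\1_(`[a, b]%classic) t)%:E)).
  apply: eq_integral => t _.
  have [tab|tab] := boolP (t \in `[a, b]%classic).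
    rewrite [in RHS]indicE tab mule1 -ih; congr lebesgue_iint; apply/funext => v.
    by rewrite indic_cube_row_mx indicE tab mul1r.
  rewrite [in RHS]indicE (negbTE tab) mule0.
  transitivity (lebesgue_iint (fun _ : 'rV[R]_n => 0)).
    congr lebesgue_iint; apply/funext => v.
    by rewrite indic_cube_row_mx indicE (negbTE tab) mul0r.
  exact: lebesgue_iint0.
rewrite ge0_integralZl_EFin//; last 2 first.
- by apply/measurable_EFinP; exact: measurable_indic.
- by rewrite exprn_ge0// subr_ge0 ltW.
rewrite integral_indic// setIT/= lebesgue_measure_itv/= lte_fin ab.
by rewrite -EFinB -EFinM exprSr.
Qed.

Let cone n : set 'rV[R]_n :=
  [set (t *: theta)%R | t in `]0%R, 1%R] & theta in @esphere R n].

Lemma sphere_area_gt0 n : (0 < n)%N -> (0 < @sphere_area R n)%R.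
Proof.
move=> n0; have n0R : (0 < n%:R :> R)%R by rewrite ltr0n.
(* the cube [1/(2n), 1/n]^n consists of nonzero vectors of the unit ball *)
have vol0 : ((2 * n%:R)^-1 ^+ n)%:E <= lebesgue_vol (@cone n).
  have -> : ((2 * n%:R)^-1 = n%:R^-1 - (2 * n%:R)^-1 :> R)%R.
    by field; rewrite gt_eqF.
  rewrite -lebesgue_vol_cube; last first.
    by rewrite ltf_pV2 ?posrE ?mulr_gt0// ltr_pMl// ltr1n.
  apply: le_lebesgue_iint => x; rewrite lee_fin ?indicE// ler_nat.
  have [xc|//] := boolP (x \in cube _ _).
  rewrite mem_set//; move: xc; rewrite inE /cube /= => xc.
  have xn i : (0 < x ord0 i <= n%:R^-1)%R.
    have /andP[h ->] := xc i; rewrite andbT (lt_le_trans _ h)//.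
    by rewrite invr_gt0 mulr_gt0.
  have ex0 : (0 < enorm x)%R.
    have /andP[h _] := xn (Ordinal n0).
    by rewrite (lt_le_trans h)// (le_trans (ler_norm _) (coord_le_enorm _ _)).
  have ex1 : (enorm x <= 1)%R.
    rewrite -(@ler_pXn2r _ 2) ?nnegrE ?enorm_ge0// sqr_enorm expr1n.
    apply: (@le_trans _ _ (\sum_(i < n) n%:R^-1)%R); last first.
      by rewrite sumr_const card_ord -[leLHS]mulr_natl mulfV// gt_eqF.
    apply: ler_sum => i _; have /andP[h1 h2] := xn i.
    rewrite (le_trans _ h2)// expr2 ler_piMl ?(ltW h1)// (le_trans h2)//.
    by rewrite invf_le1// ler1n.
  exists (enorm x); first by rewrite /= in_itv/= ex0.
  exists ((enorm x)^-1 *: x)%R; last by rewrite scalerA mulfV ?scale1r// gt_eqF.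
  by rewrite /esphere/= enormZ gtr0_norm ?invr_gt0// mulVf// gt_eqF.
(* the cone over the sphere lies in the cube [-1, 1]^n *)
have volb : lebesgue_vol (@cone n) <= ((1 - -1) ^+ n)%:E.
  rewrite -lebesgue_vol_cube; last by lra.
  apply: le_lebesgue_iint => x; rewrite lee_fin ?indicE// ler_nat.
  have [xc|//] := boolP (x \in @cone n).
  rewrite mem_set//; move: xc; rewrite inE => -[t /=]; rewrite in_itv/=.
  move=> /andP[t0 t1] [theta th1 <-] i; rewrite -ler_norml.
  rewrite (le_trans (coord_le_enorm _ _))// enormZ gtr0_norm// th1 mulr1//.
rewrite /sphere_area /surface_measure -/(@cone n).
have fin : lebesgue_vol (@cone n) \is a fin_num.
  rewrite ge0_fin_numE; first by rewrite (le_lt_trans volb)// ltry.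
  by rewrite (le_trans _ vol0)// lee_fin exprn_ge0// invr_ge0 mulr_ge0.
rewrite -(fineK fin) -EFinM/= mulr_gt0// -lte_fin fineK//.
by rewrite (lt_le_trans _ vol0)// lte_fin exprn_gt0// invr_gt0 mulr_gt0.
Qed.

End SphereArea.

(** * Holomorphic continuation of the distance *)

(** Composition with a branch s of the square root: the difference quotient of
    s o g is that of g divided by a sum of two values of s, so a positive lower
    bound on the modulus of these sums is all that is used of s. *)
Lemma derivable_root_comp (K : numFieldType) (s : K -> K) (g : K^o -> K^o)
    (z : K^o) (b : K) :
  derivable g z 1 -> 0 < b ->
  (forall p, s p - s (g z) = (p - g z) * (s p + s (g z))^-1) ->
  (forall p, b <= `|s p + s (g z)|) ->
  derivable ((fun t => s (g t)) : K^o -> K^o) z 1.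
Proof.
move=> dg b0 sB sb.
have cg : {for z, continuous g}.
  by apply/differentiable_continuous/derivable1_diffP.
have csg : {for z, continuous ((fun t => s (g t)) : K^o -> K^o)}.
  apply/(@cvgrPdist_lt K K^o _ (nbhs z) (nbhs_filter z)) => e e0; near=> t.
  have t0 : `|s (g t) + s (g z)| > 0 by rewrite (lt_le_trans b0).
  rewrite distrC sB normrM normfV ltr_pdivrMr//.
  rewrite (@lt_le_trans _ _ (e * b))// ?ler_pM2l// distrC.
  near: t; apply: (@cvgr_dist_lt K K^o _ (nbhs z) (nbhs_filter z) _ _ cg).
  by rewrite mulr_gt0.
have dgE : (fun h : K => h^-1 *: ((((fun t => s (g t)) : K^o -> K^o) \o shift z)
      (h *: (1 : K^o)) - s (g z))) =
    (fun h => (h^-1 *: ((g \o shift z) (h *: (1 : K^o)) - g z)) *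
      (s (g (h *: (1 : K^o) + z)) + s (g z))^-1).
  by apply/funext => h /=; rewrite sB -scalerAl.
apply/cvg_ex; exists ('D_1 g z * (s (g z) + s (g z))^-1).
rewrite dgE; apply: cvgM; first exact: dg.
have s0 : s (g z) + s (g z) != 0.
  by rewrite -normr_gt0 (lt_le_trans b0).
apply: cvgV => //; apply: cvgD; last exact: cvg_cst.
have /continuous_withinNshiftx := csg.
by under [X in _ -> X @ _ --> _]eq_fun do rewrite scaler1.
Unshelve. all: by end_near. Qed.

Lemma derivable_quadratic_inv (K : numFieldType) (a b : K) (z : K^o) : z != 0 ->
  derivable ((fun t => 1 - a * t^-1 + b * t^-1 ^+ 2) : K^o -> K^o) z 1.
Proof.
move=> z0.
pose inv : K^o -> K := fun t => t^-1.
have dV : derivable inv z 1 by apply: derivableV => //; exact: derivable_id.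
have d1 := derivableM (derivable_cst a z 1) dV.
have d2 := derivableM (derivable_cst b z 1) (@derivableX _ _ _ 2 _ _ dV).
exact: derivableD (derivableB (derivable_cst (1 : K) z 1) d1) d2.
Qed.

Lemma derivable_idM (K : numFieldType) (f : K^o -> K^o) (z : K^o) :
  derivable f z 1 -> derivable ((fun t : K => t * (f t : K)) : K^o -> K^o) z 1.
Proof. exact: (derivableM (@derivable_id _ _ z 1)). Qed.

Section DistanceContinuation.
Context {R : realType}.

Lemma Re_sqrtc_ge0 (w : R[i]) : 0 <= complex.Re (sqrtc w).
Proof. by case: w => a b /=; exact: sqrtr_ge0. Qed.

Lemma Re_sqrtc_gt0 (w : R[i]) :
  (complex.Im w != 0) || (0 < complex.Re w) -> 0 < complex.Re (sqrtc w).
Proof.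
case: w => a b /= ab; rewrite sqrtr_gt0 divr_gt0// -(opprK a) subr_gt0 opprK.
have /orP[b0|a0] := ab.
  rewrite (le_lt_trans (ler_norm _))// normrN -sqrtr_sqr ltr_sqrt.
    by rewrite ltrDl exprn_even_gt0.
  by rewrite ltr_wpDl ?sqr_ge0// exprn_even_gt0.
by rewrite (@lt_le_trans _ _ 0) ?oppr_lt0// sqrtr_ge0.
Qed.

Let normc_ge_Re1 (z : R[i]) : (complex.Re z)%:C <= `|z|.
Proof. by rewrite (le_trans _ (normc_ge_Re z))// lecR ler_norm. Qed.

(** Values of the principal root have nonnegative real part, so the sum of two
    of them, one with positive real part, cannot vanish. *)
Lemma sqrtcB (p q : R[i]) : 0 < complex.Re (sqrtc q) ->
  sqrtc p - sqrtc q = (p - q) * (sqrtc p + sqrtc q)^-1.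
Proof.
move=> q0.
have s0 : sqrtc p + sqrtc q != 0.
  apply/eqP => /(congr1 (@complex.Re R)); rewrite raddfD/= => s0.
  by have := Re_sqrtc_ge0 p; lra.
apply: (mulIf s0); rewrite mulfVK// -subr_sqr.
by rewrite !sqr_sqrtc.
Qed.

Lemma derivable_sqrtc (g : R[i]^o -> R[i]^o) (z : R[i]^o) :
  derivable g z 1 -> 0 < complex.Re (sqrtc (g z)) ->
  derivable ((fun t => sqrtc (g t)) : R[i]^o -> R[i]^o) z 1.
Proof.
move=> dg g0; set b := (complex.Re (sqrtc (g z)))%:C.
apply: (@derivable_root_comp _ (@sqrtc R) g z b) => //.
- by rewrite /b ltcR.
- by move=> p; exact: sqrtcB.
- move=> p; rewrite (le_trans _ (normc_ge_Re1 _))// lecR raddfD/= lerDr.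
  exact: Re_sqrtc_ge0.
Qed.

(** A root z of 1 + tau - 2 c z + r2 z^2 with c^2 <= r2 and tau >= 0 satisfies
    r2 |z|^2 >= 1; hence 1 - 2 c z + r2 z^2 avoids the cut ]-oo, 0] of the
    square root as long as r2 |z|^2 < 1. *)
Lemma quadratic_off_cut (c r2 u v : R) : c ^+ 2 <= r2 ->
  r2 * (u ^+ 2 + v ^+ 2) < 1 -> v * (r2 * u - c) = 0 ->
  0 < 1 - 2 * c * u + r2 * (u ^+ 2 - v ^+ 2).
Proof.
move=> cr ruv /eqP; rewrite mulf_eq0 => /orP[/eqP v0|/eqP ruc].
  rewrite v0 expr0n/= addr0 in ruv; rewrite v0 expr0n/= subr0.
  have cu2 : (c * u) ^+ 2 <= r2 * u ^+ 2 by rewrite exprMn ler_wpM2r ?sqr_ge0.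
  have cu1 : c * u != 1.
    by apply/eqP => cu; have := le_lt_trans cu2 ruv; rewrite cu expr1n ltxx.
  have : 0 < (1 - c * u) ^+ 2 by rewrite exprn_even_gt0//= subr_eq0 eq_sym.
  by have := cu2; rewrite exprMn; nra.
have -> : c = r2 * u by lra.
nra.
Qed.

(** The continuation is zeta sqrt(1 - 2 c / zeta + |x|^2 / zeta^2) with
    c = <theta, x>. The radicand stays off the cut by quadratic_off_cut with
    z = 1 / zeta, so a single principal root suffices. *)
Lemma dist_continuation_exists n (rad : R) (theta x : 'rV[R]_n) :
  0 < rad -> enorm theta = 1 -> enorm x <= rad ->
  exists f, is_dist_continuation rad theta x f.
Proof.
move=> rad0 th1 xr.
pose c := \sum_i theta ord0 i * x ord0 i; pose r2 := enorm x ^+ 2.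
have cr : c ^+ 2 <= r2 by have := dot_sqr_le theta x; rewrite th1 expr1n mul1r.
pose g (z : R[i]) : R[i] := 1 - (2 * c)%:C * z^-1 + r2%:C * z^-1 ^+ 2.
exists (fun z => z * sqrtc (g z)); split.
  move=> z zrad.
  have nz0 : 0 < `|z| by rewrite (lt_trans _ zrad)// ltcR.
  have z0 : z != 0 by rewrite -normr_gt0.
  have dg : derivable (g : R[i]^o -> R[i]^o) z 1 by exact: derivable_quadratic_inv.
  apply: derivable_idM; apply: derivable_sqrtc => //; apply: Re_sqrtc_gt0; rewrite /g.
  have : r2%:C * `|z^-1| ^+ 2 < 1.
    rewrite normfV exprVn ltr_pdivrMr ?exprn_gt0// mul1r.
    rewrite /r2 rmorphXn/= ltr_pXn2r ?nnegrE ?normr_ge0 ?ler0c ?enorm_ge0//.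
    by rewrite (le_lt_trans _ zrad)// lecR.
  move: (z^-1) => {dg z0 nz0 zrad z} [u v].
  rewrite -add_Re2_Im2 -rmorphM ltcR => ruv.
  have -> : 1 - (2 * c)%:C * (u +i* v) + r2%:C * (u +i* v) ^+ 2 =
      (1 - 2 * c * u + r2 * (u ^+ 2 - v ^+ 2)) +i* (2 * (v * (r2 * u - c))).
    by rewrite expr2; apply/eqP; rewrite eq_complex/=; apply/andP; split; apply/eqP; ring.
  have [v0|v0] := eqVneq (v * (r2 * u - c)) 0; apply/orP.
    by right; exact: quadratic_off_cut.
  by left; rewrite /= mulf_neq0.
move=> rho rrho; have rho0 : 0 < rho by rewrite (lt_trans rad0).
pose d := enorm (rho *: theta - x).
have d2 : d ^+ 2 = rho ^+ 2 - 2 * c * rho + r2.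
  rewrite /d sqr_enorm /r2 sqr_enorm /c.
  have th2 : \sum_i theta ord0 i ^+ 2 = 1 by rewrite -sqr_enorm th1 expr1n.
  transitivity (rho ^+ 2 * (\sum_i theta ord0 i ^+ 2) - 2 * rho * c
    + \sum_i x ord0 i ^+ 2); last by rewrite th2 mulr1 /c mulrAC.
  rewrite /c !mulr_sumr -sumrN -!big_split/=.
  by apply: eq_bigr => i _; rewrite !mxE; ring.
have d0 : 0 < d by rewrite (enorm_sub_gt0 xr)// enormZ th1 mulr1 gtr0_norm.
have -> : g rho%:C = ((d / rho) ^+ 2)%:C.
  rewrite exprMn exprVn d2 /g -rmorphV ?unitfE ?gt_eqF//= -rmorphXn -!rmorphM/=.
  rewrite -[X in X - _](rmorph1 (real_complex R)) -rmorphB -rmorphD/=.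
  congr (_%:C); field; rewrite gt_eqF//.
rewrite sqrtc_sqrtr ?ler0c ?sqr_ge0//= sqrtr_sqr ger0_norm; last first.
  by rewrite divr_ge0// ltW.
by rewrite -rmorphM/= mulrC divfK// gt_eqF.
Qed.

(** Every continuation takes the prescribed values on the real half-line, so
    the choice made by dist_ext is immaterial there. *)
Lemma dist_ext_real n (rad rho : R) (theta x : 'rV[R]_n) :
  0 < rad -> enorm theta = 1 -> enorm x <= rad -> rad < rho ->
  dist_ext rad theta x rho%:C = (enorm (rho *: theta - x))%:C.
Proof.
move=> rad0 th1 xr rrho.
have ex : exists f, [set f | is_dist_continuation rad theta x f] f.
  exact: dist_continuation_exists.
by have [_] := xgetPex (fun=> 0) ex; apply.
Qed.

End DistanceContinuation.

(** * Signed measures *)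

Section JordanDecomposition.
Context d (T : measurableType d) (R : realType).
Implicit Types mu nu : {charge set T -> \bar R}.

Lemma charge_pos_lty mu : (charge_pos mu setT < +oo)%E.
Proof.
by rewrite -ge0_fin_numE// (fin_num_measure (jordan_pos (hahn_pairP mu))).
Qed.

Lemma charge_neg_lty mu : (charge_neg mu setT < +oo)%E.
Proof.
by rewrite -ge0_fin_numE// (fin_num_measure (jordan_neg (hahn_pairP mu))).
Qed.

Lemma charge_jordanE mu A : measurable A ->
  mu A = (charge_pos mu A - charge_neg mu A)%E.
Proof.
by move=> mA; rewrite (jordan_decomp (hahn_pairP mu) mA) /cadd/= cscaleN1.
Qed.

End JordanDecomposition.

(** Outside the support every point has a neighbourhood that is null for the
    total variation, hence for both Jordan components. *)
Lemma charge_support_null (R : realType) n (mu : {charge set (borel_rV R n) -> \bar R})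
    (C : set (borel_rV R n)) : measurable C -> charge_support mu `<=` C ->
  charge_pos mu (~` C) = 0 /\ charge_neg mu (~` C) = 0.
Proof.
move=> mC muC.
have null x : ~ C x -> exists U : set 'rV[R]_n,
    [/\ open U, U x, charge_pos mu U = 0 & charge_neg mu U = 0].
  move=> Cx; have /existsNP[U] : ~ charge_support mu x by move/muC.
  move=> /not_implyP[oU /not_implyP[Ux /negP]]; rewrite -leNgt => var0.
  exists U; split => //; apply/eqP; rewrite eq_le measure_ge0 andbT.
    by rewrite (le_trans _ var0)// /charge_variation leeDl//; exact: measure_ge0.
  by rewrite (le_trans _ var0)// /charge_variation leeDr//; exact: measure_ge0.
by split; apply: locally_null_measure0; try exact: measurableC;
  move=> x /null[U [oU Ux U1 U2]]; exists U.
Qed.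

Theorem theorem3 (R : realType) (n : nat) (n_gt0 : (0 < n)%N)
  (mu nu : {charge set (borel_rV R n) -> \bar R})
  (mu_compact : compact (charge_support mu))
  (nu_compact : compact (charge_support nu)) :
  (exists rad : R,
    [/\ 0 < rad,
        charge_support mu `<=` ecball rad,
        charge_support nu `<=` ecball rad &
        forall (zeta : R[i]) (theta : 'rV[R]_n),
          rad%:C < `|zeta| -> esphere theta ->
          markov_transform rad mu zeta theta =
          markov_transform rad nu zeta theta]) ->
  forall A : set (borel_rV R n), measurable A -> mu A = nu A.
Proof.
move=> [rad [rad0 mu_rad nu_rad eqM]].
set B : set (borel_rV R n) := ecball rad.
have mB : measurable B by exact: measurable_ecball.
have [mup0 mun0] := charge_support_null mB mu_rad.
have [nup0 nun0] := charge_support_null mB nu_rad.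
pose alpha : {measure set (borel_rV R n) -> \bar R} :=
  measure_add (charge_pos mu) (charge_neg nu).
pose beta : {measure set (borel_rV R n) -> \bar R} :=
  measure_add (charge_pos nu) (charge_neg mu).
have alphaE C : alpha C = (charge_pos mu C + charge_neg nu C)%E.
  exact: measure_addE.
have betaE C : beta C = (charge_pos nu C + charge_neg mu C)%E.
  exact: measure_addE.
have eqab : forall A, measurable A -> alpha A = beta A.
  apply: (eq_measure_riesz n_gt0 rad0).
  - by rewrite alphaE lte_add_pinfty ?charge_pos_lty ?charge_neg_lty.
  - by rewrite betaE lte_add_pinfty ?charge_pos_lty ?charge_neg_lty.
  - by rewrite alphaE [X in (X + _)%E]mup0 [X in (_ + X)%E]nun0 adde0.
  - by rewrite betaE [X in (X + _)%E]nup0 [X in (_ + X)%E]mun0 adde0.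
  move=> y ry; have y0 : 0 < enorm y by rewrite (lt_trans rad0).
  pose k (x : borel_rV R n) : R := (enorm (y - (x : 'rV[R]_n)))^-1 ^+ n.
  have intk (m : {measure set (borel_rV R n) -> \bar R}) :
      (m setT < +oo)%E -> m.-integrable B (EFin \o k).
    move=> moo; apply: integrable_bounded_measurable => //.
    exact: (bounded_measurable_riesz n ry).
  have k0 x : B x -> (0 <= (k x)%:E)%E.
    by move=> _; rewrite lee_fin exprn_ge0// invr_ge0 enorm_ge0.
  have mk : measurable_fun B (EFin \o k).
    by have /integrableP[] := intk _ (charge_pos_lty mu).
  have int_add (m1 m2 : {measure set (borel_rV R n) -> \bar R}) :
      (m1 setT < +oo)%E -> (m2 setT < +oo)%E ->
      (\int[measure_add m1 m2]_(x in B) k x =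
       \int[m1]_(x in B) k x + \int[m2]_(x in B) k x)%R.
    move=> m1oo m2oo; rewrite /Rintegral ge0_integral_measure_add// fineD//.
    - by apply: integrable_fin_num => //; exact: intk.
    - by apply: integrable_fin_num => //; exact: intk.
  rewrite [LHS](int_add _ _ (charge_pos_lty mu) (charge_neg_lty nu)).
  rewrite [RHS](int_add _ _ (charge_pos_lty nu) (charge_neg_lty mu)).
  pose theta := (enorm y)^-1 *: y.
  have th1 : enorm theta = 1 by rewrite enormZ gtr0_norm ?invr_gt0// mulVf// gt_eqF.
  have yE : enorm y *: theta = y by rewrite scalerA mulfV ?scale1r// gt_eqF.
  have rC : rad%:C < `|(enorm y)%:C| :> R[i].
    by rewrite normc_def/= expr0n/= addr0 sqrtr_sqr gtr0_norm// ltcR.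
  have := eqM _ theta rC th1; rewrite /markov_transform.
  have area0 : (@sphere_area R n)^-1%:C != 0.
    by rewrite fmorph_eq0 invr_eq0 gt_eqF// sphere_area_gt0.
  move=> /(mulfI area0)/(congr1 (@complex.Re R)); rewrite /charge_integralC/=.
  have intE (m : {measure set (borel_rV R n) -> \bar R}) : (m setT < +oo)%E ->
      (\int[m]_(x in B) complex.Re
        ((enorm y)%:C ^+ n.-1 / dist_ext rad theta x (enorm y)%:C ^+ n))%R =
      enorm y ^+ n.-1 * (\int[m]_(x in B) k x)%R.
    move=> moo; rewrite -RintegralZl//; last exact: intk.
    apply: eq_Rintegral => x; rewrite inE => Bx.
    rewrite dist_ext_real// yE -!(rmorphXn (real_complex R)).
    rewrite -(fmorphV (real_complex R)) -(rmorphM (real_complex R))/=.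
    by rewrite /k exprVn.
  rewrite /charge_integral !intE ?charge_pos_lty ?charge_neg_lty//.
  rewrite -!mulrBr => /(mulfI _) h; have := h (expf_neq0 _ (lt0r_neq0 y0)).
  lra.
move=> A mA; have := eqab A mA.
rewrite alphaE betaE !charge_jordanE//.
have fin (m : {measure set (borel_rV R n) -> \bar R}) :
    (m setT < +oo)%E -> m A \is a fin_num.
  move=> moo; rewrite ge0_fin_numE// (le_lt_trans _ moo)//.
  by apply: le_measure; rewrite ?inE.
have := fin _ (charge_pos_lty mu); have := fin _ (charge_neg_lty mu).
have := fin _ (charge_pos_lty nu); have := fin _ (charge_neg_lty nu).
move: (charge_pos mu A) (charge_neg mu A) (charge_pos nu A) (charge_neg nu A).
move=> [a| |] [b| |] [c| |] [e| |]//= _ _ _ _ [abce]; congr EFin; lra.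
Qed.
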